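(* Let $n\ge 2$ and let $M$ be the $n\times n$ real matrix with entries $$M(i,j)=\frac{1}{2^i}\left(\binom{i-1}{j-1}+\binom{i-1}{n-j}\right),\qquad 1\le i,j\le n.$$ Then: 1. $\ker(M)=\operatorname{span}\{\eta^{(j)}:1\le j\le\lfloor n/2\rfloor\}$, where $\eta^{(j)}:=e_j-e_{n-j+1}$ and $e_1,\dots,e_n$ is the standard basis of $\mathbb{R}^n$. 2. For every even integer $i$ with $0\le i\le n-1$, $2^{-i}$ is an eigenvalue of $M$ with multiplicity $1$. 3. For every even integer $i$ with $0\le i\le n-1$, the vector $\zeta^{(i)}\in\mathbb{R}^n$ given by $$\zeta^{(i)}(k)=\sum_{t=0}^{i}w^{(i)}_t\,(k-1)^{\underline{t}},\qquad 1\le k\le n,$$ where $$w^{(i)}_t=2^{i-t}B_{i-t}\binom{i}{t}(n-t-1)^{\underline{i-t}}=2^{i-t}B_{i-t}\binom{i}{t}\frac{(n-t-1)!}{(n-i-1)!},$$ is an eigenvector of $M$ with eigenvalue $2^{-i}$, i.e. $M\zeta^{(i)}=2^{-i}\zeta^{(i)}$.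
   Context: $M$ is the position matrix of a single-shelf shuffle of $n$ cards: $M(i,j)$ is the probability that card $i$ is in position $j$ after one shuffle. Matrices act on column vectors. Binomial convention: $\binom{0}{0}=1$ and $\binom{a}{b}=0$ for $a<b$. Falling factorial: $x^{\underline{t}}=x(x-1)\cdots(x-t+1)$, with $x^{\underline{0}}=1$; in particular $x^{\underline{t}}=0$ for integers $t>x\ge 0$. $B_k$ denotes the Bernoulli numbers, defined by $\frac{z}{e^z-1}=\sum_{k\ge0}B_k\frac{z^k}{k!}$ (so $B_0=1$, $B_1=-\tfrac12$). *)

(* Defs.v *)
From HB Require Import structures.
From mathcomp Require Import all_boot all_order all_algebra.
From mathcomp Require Import reals.

Set Implicit Arguments.
Unset Strict Implicit.
Unset Printing Implicit Defensive.

Import Order.TTheory GRing.Theory Num.Theory.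
Local Open Scope ring_scope.

(* An index i : 'I_n stands for the card or position i.+1, so that i - 1 and
   n - j of the 1-based formula become i and n - j.+1. *)
Definition shelf_mx (R : realType) (n : nat) : 'M[R]_n :=
  \matrix_(i < n, j < n)
    ((2 ^+ i.+1)^-1 * ('C(i, j)%:R + 'C(i, n - j.+1)%:R)).

(* e_j with j counted from 1. *)
Definition std_vec (R : realType) (n j : nat) : 'cV[R]_n :=
  \col_(k < n) ((k.+1 == j)%N%:R).

Definition eta_vec (R : realType) (n j : nat) : 'cV[R]_n :=
  std_vec R n j - std_vec R n (n - j + 1).

(* Formal power series are represented by their coefficient sequences. *)
Definition fps_mul (R : realType) (a b : nat -> R) (m : nat) : R :=
  \sum_(k < m.+1) a k * b (m - k)%N.

Definition expm1_coef (R : realType) (m : nat) : R :=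
  (m`!%:R)^-1 - (m == 0)%N%:R.

(* z / (e^z - 1) = \sum_k B_k z^k / k!, multiplied out by e^z - 1. *)
Definition bernoulli_numbers (R : realType) (B : nat -> R) : Prop :=
  forall m : nat,
    fps_mul (fun k => B k / k`!%:R) (expm1_coef R) m = (m == 1)%N%:R.

Lemma bernoulli_numbers_unique (R : realType) (B B' : nat -> R) :
  bernoulli_numbers B -> bernoulli_numbers B' -> B =1 B'.
Proof.
move=> hB hB' m; elim/ltn_ind: m => m IH.
have := hB m.+1; rewrite -(hB' m.+1) /fps_mul !big_ord_recr /= subnn.
rewrite subSnn /expm1_coef /= fact0 factS fact0 invr1 !subr0 subrr !mulr0.
rewrite !addr0 !mulr1.
rewrite (eq_bigr (fun k : 'I_m =>
  B' k / k`!%:R * ((m.+1 - k)`!%:R^-1 - (m.+1 - k == 0)%N%:R))); last first.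
  by move=> k _; rewrite IH.
by move/addrI/mulIf; apply; rewrite invr_eq0 pnatr_eq0 -lt0n fact_gt0.
Qed.

Lemma bernoulli_numbers_exist (R : realType) :
  exists B : nat -> R, bernoulli_numbers B.
Proof.
pose next (s : seq R) : R := (size s)`!%:R *
  ((size s == 0)%N%:R -
   \sum_(k < size s) s`_k / k`!%:R * expm1_coef R ((size s).+1 - k)).
pose fix bs m := if m is m'.+1 then rcons (bs m') (next (bs m')) else [::].
have size_bs m : size (bs m) = m by elim: m => //= m IH; rewrite size_rcons IH.
have nth_bs k m : (k < m)%N -> (bs m)`_k = next (bs k).
  elim: m => // m IH; rewrite ltnS leq_eqVlt => /orP[/eqP->|lt_km] /=.
    by rewrite nth_rcons size_bs ltnn eqxx.
  by rewrite nth_rcons size_bs lt_km IH.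
exists (fun m => next (bs m)) => -[|m]; rewrite /fps_mul.
  by rewrite big_ord_recr big_ord0 /= subnn /expm1_coef fact0 invr1 subrr mulr0
    addr0.
rewrite !big_ord_recr /= subnn subSnn.
rewrite [expm1_coef R 0]/expm1_coef [expm1_coef R 1]/expm1_coef /=.
rewrite fact0 factS fact0 invr1 subr0 subrr mulr0 addr0 mulr1.
rewrite {2}/next size_bs [X in _ + X]mulrC mulKf; last first.
  by rewrite pnatr_eq0 -lt0n fact_gt0.
rewrite addrC eqSS -[RHS]addr0 -addrA; congr (_ + _); apply/eqP.
rewrite addrC subr_eq0; apply/eqP/eq_bigr => k _.
by rewrite nth_bs.
Qed.

(* The factor (n - t - 1) falling to order i - t is computed in nat; for
   t <= i <= n - 1 no subtraction here truncates. *)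
Definition w_coef (R : realType) (n : nat) (B : nat -> R) (i t : nat) : R :=
  2 ^+ (i - t) * B (i - t)%N * 'C(i, t)%:R * ((n - t - 1) ^_ (i - t))%:R.

(* k : 'I_n stands for the 1-based coordinate k.+1, whence k for k - 1. *)
Definition zeta_vec (R : realType) (n : nat) (B : nat -> R) (i : nat) :
    'cV[R]_n :=
  \col_(k < n) (\sum_(t < i.+1) w_coef n B i t * (k ^_ t)%:R).

(* Main.v *)
(* Let N = n - 1 and index cards from 0. Row x of M averages f(X) and f(N - X)
   over X binomial(x, 1/2), so M = A S with S the symmetrisation under
   x -> N - x and A the invertible binomial averaging; hence ker M = ker S.
   Identify a polynomial p of degree at most N with the vector of its Bernstein
   coefficients of degree N. This sends 'X^t to x^_t / N^_t, turns the reversal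
   x -> N - x into the substitution 1 - 'X and A into 'X / 2, so that M becomes
     T p = (p('X/2) + p(1 - 'X/2)) / 2.
   T is triangular in the monomial basis with diagonal entries 2^-t for t even
   and 0 for t odd, which gives the multiplicities. Finally zeta^(i) is a
   multiple of 2^i B_i('X/2), with B_i the Bernoulli polynomial, and for i even
   the eigenvector equation is the duplication formula combined with
   B_i(1 - 'X) = B_i('X). *)
Require Import Defs.
From mathcomp Require Import all_boot all_order all_algebra.
From mathcomp Require Import reals ring lra zify.

Set Implicit Arguments.
Unset Strict Implicit.
Unset Printing Implicit Defensive.

Import Order.TTheory GRing.Theory Num.Theory.
Local Open Scope ring_scope.

(** * Appell sequences determined by their forward differences *)

Lemma periodic_poly_const (R : numDomainType) (p : {poly R}) :
  p \Po ('X + 1) = p -> p = (p.[0])%:P.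
Proof.
move=> pp; have pn k : p.[k%:R] = p.[0].
  elim: k => // k IH; rewrite -IH -{2}pp horner_comp !hornerE.
  by rewrite -natr1.
apply/eqP; rewrite -subr_eq0; apply/eqP.
set q := p - _.
apply: (@roots_geq_poly_eq0 _ q [seq k%:R | k <- iota 0 (size q)]).
- by apply/allP => _ /mapP[k _ ->]; rewrite /root /q !hornerE pn subrr.
- by rewrite map_inj_uniq ?iota_uniq // => a b /eqP; rewrite eqr_nat => /eqP.
- by rewrite size_map size_iota.
Qed.

Lemma deriv_eq0 (R : numDomainType) (p : {poly R}) :
  p^`() = 0 -> p = (p.[0])%:P.
Proof.
move=> dp; apply/polyP => -[|k]; rewrite coefC /= ?horner_coef0 //.
have /eqP := coef_deriv p k; rewrite dp coef0 eq_sym mulrn_eq0 /=.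
by move=> /eqP.
Qed.

(** [F i.+1 - G i.+1] is 1-periodic, hence constant; its derivative is a nonzero multiple of
    [F i - G i]. *)
Lemma appell_unique (R : numDomainType) (F G : nat -> {poly R}) :
    (forall i, (F i.+1)^`() = i.+1%:R *: F i) ->
    (forall i, (G i.+1)^`() = i.+1%:R *: G i) ->
    (forall i, F i \Po ('X + 1) - F i = G i \Po ('X + 1) - G i) ->
  F =1 G.
Proof.
move=> dF dG FG i.
have : F i.+1 - G i.+1 = ((F i.+1 - G i.+1).[0])%:P.
  apply: periodic_poly_const; apply/eqP; rewrite comp_polyB -subr_eq0.
  have := FG i.+1; move: (_ \Po _) (_ \Po _) => a b /eqP.
  rewrite -subr_eq0 => /eqP <-; apply/eqP; ring.
move/(congr1 deriv); rewrite derivB dF dG derivC -scalerBr => /eqP.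
by rewrite scale_poly_eq0 pnatr_eq0 /= subr_eq0 => /eqP.
Qed.

(** * Bernoulli polynomials: difference, reflection, duplication *)

Section BernoulliPoly.
Variables (R : realType) (B : nat -> R).
Hypothesis hB : bernoulli_numbers B.

Definition bernoulli_poly (i : nat) : {poly R} :=
  \poly_(t < i.+1) (B (i - t)%N *+ 'C(i, t)).

(** Coefficient [m] of the defining product, times [m] factorial; the term [k = m] drops out because
    [e^z - 1] has no constant term. *)
Lemma bernoulli_sum (m : nat) :
  \sum_(k < m) B k *+ 'C(m, k) = (m == 1)%N%:R.
Proof.
have := hB m; rewrite /fps_mul big_ord_recr /= subnn /expm1_coef.
rewrite fact0 invr1 subrr mulr0 addr0 => /(congr1 ( *%R m`!%:R)).
rewrite mulr_sumr => E.
rewrite -[RHS](_ : m`!%:R * (m == 1)%N%:R = _); last first.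
  by case: m {E} => [|[|m]]; rewrite ?mulr0 ?mulr1.
rewrite -E; apply: eq_bigr => k _.
rewrite -mulr_natr -(bin_fact (ltnW (ltn_ord k))) !natrM.
rewrite [(m - k == 0)%N]subn_eq0 leqNgt ltn_ord subr0.
by field; rewrite !pnatr_eq0 -!lt0n !fact_gt0.
Qed.

Lemma deriv_bernoulli_poly (i : nat) :
  (bernoulli_poly i.+1)^`() = i.+1%:R *: bernoulli_poly i.
Proof.
apply/polyP => t; rewrite coef_deriv coefZ !coef_poly subSS ltnS.
case: ifP => ht; last by rewrite mul0rn mulr0.
by rewrite -mulrnA mulnC -mul_bin_diag mulrnA mulrnAr mulr_natl mulrnAC.
Qed.

(** Differentiating the identity at [i.+1] gives [i.+1] times the one at [i], so only the value at 0
    remains to be checked. *)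
Lemma bernoulli_poly_diff (i : nat) :
  bernoulli_poly i \Po ('X + 1) - bernoulli_poly i = i%:R *: 'X^(i.-1).
Proof.
elim: i => [|i IH].
  rewrite /bernoulli_poly (_ : \poly_(t < 1) _ = (B 0)%:P).
    by rewrite comp_polyC subrr scale0r.
  by apply/polyP => -[|t]; rewrite coef_poly coefC.
apply/eqP; rewrite -subr_eq0; set q := _ - _.
have /deriv_eq0 -> : q^`() = 0.
  rewrite /q !derivB deriv_comp derivD derivX derivC addr0 mulr1.
  rewrite deriv_bernoulli_poly derivZ derivXn comp_polyZ -scalerBr IH.
  by rewrite scaler_nat -scalerMnr scaler_nat subrr.
rewrite polyC_eq0 /q !(hornerE, horner_comp).
rewrite horner_coef0 coef_poly /= horner_poly.
(* In the reversed sum for the value at 1, the last term [B i.+1] cancels the value at 0 and the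
   others form [bernoulli_sum]. *)
rewrite (reindex_inj rev_ord_inj) big_ord_recr /= subnn subn0 expr1n.
have -> : \sum_(k < i.+1) B (i.+1 - (i.+2 - k.+1))%N *+
      'C(i.+1, i.+2 - k.+1) * 1 ^+ (i.+2 - k.+1) = (i == 0)%N%:R :> R.
  rewrite -(bernoulli_sum i.+1); apply: eq_bigr => k _.
  by rewrite expr1n mulr1 subKn ?bin_sub // ltnW.
rewrite bin0 mulr1n; case: (i) => *;
  rewrite ?expr0n /=; apply/eqP; ring.
Qed.

(** Both sides are Appell sequences with difference [i 'X^(i-1)]; the sign absorbs the inner
    derivative [-1]. *)
Lemma bernoulli_poly_reflect (i : nat) :
  (-1) ^+ i *: (bernoulli_poly i \Po (1 - 'X)) = bernoulli_poly i.
Proof.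
apply: (@appell_unique _ (fun i =>
  (-1) ^+ i *: (bernoulli_poly i \Po (1 - 'X)))) => {}i.
- rewrite derivZ deriv_comp deriv_bernoulli_poly derivB derivX derivC sub0r.
  by rewrite mulrN1 comp_polyZ -scalerN !scalerA exprS -!scaleN1r !scalerA;
    congr (_ *: _); ring.
- exact: deriv_bernoulli_poly.
- rewrite bernoulli_poly_diff comp_polyZ -comp_polyA -scalerBr.
  rewrite comp_polyB comp_polyC comp_polyX.
  have -> : 1 - ('X + 1) = - 'X :> {poly R} by ring.
  (* The difference equation at [- 'X]. *)
  have -> : bernoulli_poly i \Po - 'X - (bernoulli_poly i \Po (1 - 'X))
      = - (i%:R *: (- 'X) ^+ i.-1).
    rewrite -comp_Xn_poly -comp_polyZ -bernoulli_poly_diff comp_polyB opprB.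
    by rewrite -comp_polyA comp_polyD comp_polyC comp_polyX [- 'X + _]addrC.
  case: (i) => [|m] /=; first by rewrite !scale0r oppr0 scaler0.
  rewrite [(- 'X) ^+ m]exprNn -!mul_polyC rmorphXn rmorphN1 exprS.
  have /(congr1 ( *%R^~ 'X^m)) : (-1) ^+ m * (-1) ^+ m = 1 :> {poly R}.
    by rewrite -exprMn mulrNN mulr1 expr1n.
  rewrite mul1r => {2}<-.
  ring.
Qed.

(** The factor [2^i / 2] makes the left side an Appell sequence; in its difference two half-steps
    telescope to a unit step from ['X / 2]. *)
Lemma bernoulli_poly_dup (i : nat) :
  (2 ^+ i / 2) *: ((bernoulli_poly i \Po (2^-1 *: 'X))
     + (bernoulli_poly i \Po (2^-1 *: ('X + 1)))) = bernoulli_poly i.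
Proof.
apply: (@appell_unique _ (fun i => (2 ^+ i / 2) *:
  ((bernoulli_poly i \Po (2^-1 *: 'X))
     + (bernoulli_poly i \Po (2^-1 *: ('X + 1)))))) => {}i.
- rewrite /= derivZ derivD !deriv_comp deriv_bernoulli_poly !derivZ derivD.
  rewrite derivX derivC addr0 -!scalerAr !mulr1 -scalerDr !comp_polyZ -scalerDr.
  by rewrite !scalerA exprS; congr (_ *: _); field.
- exact: deriv_bernoulli_poly.
rewrite comp_polyZ comp_polyD -!comp_polyA !comp_polyZ comp_polyD comp_polyX.
rewrite comp_polyC -scalerBr addrC opprD addrACA addrA.
have -> : 2^-1 *: ('X + 1 + 1) = (2^-1 *: 'X) + 1 :> {poly R}.
  by rewrite -addrA scalerDr -mulr2n -scaler_nat scalerA mulVf ?scale1r //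
    pnatr_eq0.
rewrite addrK addrC bernoulli_poly_diff; have := bernoulli_poly_diff i.
move=> /(congr1 (fun p => p \Po (2^-1 *: 'X))).
rewrite comp_polyB -comp_polyA comp_polyD comp_polyC comp_polyX => ->.
rewrite comp_polyZ comp_Xn_poly exprZn !scalerA; case: i => [|i].
  by rewrite mulr0 mul0r !scale0r.
rewrite exprS /= exprVn; congr (_ *: _); field.
by rewrite expf_neq0 ?pnatr_eq0.
Qed.

End BernoulliPoly.

(** * Falling factorials and binomial sums *)

Lemma ffactD n s u : (n ^_ (s + u) = n ^_ s * (n - s) ^_ u)%N.
Proof.
elim: u => [|u IH]; first by rewrite addn0 muln1.
by rewrite addnS !ffactnSr IH subnDA mulnA.
Qed.

(** Inclusion-exclusion for the [t]-subsets of an [N]-set that avoid [x] given elements. *)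
Lemma bin_sub_altsum (R : comPzRingType) (x N t : nat) : (x <= N)%N ->
  'C(N - x, t)%:R
    = \sum_(s < t.+1) (-1) ^+ s * ('C(x, s) * 'C(N - s, t - s))%:R :> R.
Proof.
elim: x N t => [|x IH] N t.
  rewrite big_ord_recl big1 /= => [|s _]; last by rewrite mul0n mulr0.
  by rewrite !subn0 mul1r mul1n addr0.
case: N => // N; rewrite ltnS subSS => xN.
rewrite big_ord_recl /= !subn0 !bin0 mul1n mul1r.
case: t => [|t]; first by rewrite big_ord0 addr0 !bin0.
(* By Pascal's rule, ['C(N - x, t.+1)] is the case [N.+1, t.+1] minus the case [N, t]. *)
have := IH N.+1 t.+1 (leqW xN); rewrite big_ord_recl /= subn0 bin0 mul1n mul1r.
rewrite subSn // binS natrD -[LHS]addrC (IH N t xN).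
move=> /eqP; rewrite addrC -subr_eq => /eqP <-.
rewrite -[LHS]addr0 -!addrA; congr (_ + _); rewrite addrA -sumrB -big_split.
rewrite big1 // => s _; rewrite /bump /= !add1n !subSS binS mulnDl natrD exprS.
ring.
Qed.

(** The [t]-th factorial moment of a binomial(x, 1/2) variable, cleared of denominators; the
    induction absorbs [j] into ['C(x, j)]. *)
Lemma sum_bin_ffact (x t : nat) :
  (2 ^ t * \sum_(j < x.+1) 'C(x, j) * j ^_ t = 2 ^ x * x ^_ t)%N.
Proof.
elim: t x => [|t IH] x.
  rewrite expn0 mul1n muln1; apply/esym/(etrans (expnDn 1 1 x)).
  by apply: eq_bigr => j _; rewrite !exp1n.
case: x => [|x]; first by rewrite big_ord1 !ffact0n !muln0.
rewrite big_ord_recl ffact0n muln0 add0n.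
under eq_bigr => j _ do rewrite lift0 ffactnS /= mulnA [(_ * j.+1)%N]mulnC
  -mul_bin_diag -mulnA.
by rewrite -big_distrr /= ffactnS /= mulnCA expnS -mulnA IH expnS; ring.
Qed.

(** * The operator [T] on polynomials *)

Section ShelfPoly.
Variable R : realType.
Implicit Types (p : {poly R}).

(** The operator [T], written as symmetrisation under [1 - 'X] followed by ['X / 2], to match
    [M = A S]. *)
Definition shelf_op p : {poly R} :=
  2^-1 *: ((p + (p \Po (1 - 'X))) \Po (2^-1 *: 'X)).

(** The bound [n] is free: [s.+1] isolates the diagonal of [T], [N.+1] fits the Bernstein basis. *)
Lemma coef_comp_1BX p s n : (size p <= n)%N ->
  (p \Po (1 - 'X))`_s = \sum_(t < n) p`_t * ((-1) ^+ s * 'C(t, s)%:R).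
Proof.
move=> pn; rewrite coef_comp_poly.
rewrite (big_ord_widen _ (fun t => p`_t * ((1 - 'X) ^+ t)`_s) pn) big_mkcond.
apply: eq_bigr => t _; case: ltnP => [_|pt]; last first.
  by rewrite nth_default // mul0r.
congr (_ * _); rewrite exprBn coef_sum.
under eq_bigr => k _ do rewrite expr1n mulr1 coefMn -polyCN -polyC_exp
    coefCM coefXn.
have [st|ts] := ltnP s t.+1.
  rewrite (bigD1 (Ordinal st)) //= eqxx mulr1 mulr_natr big1 ?addr0 // => k ks.
  by rewrite (_ : (s == k) = false) ?mulr0 ?mul0rn // eq_sym; apply: negbTE.
rewrite bin_small // mulr0 big1 // => k _.
by rewrite gtn_eqF ?mulr0 ?mul0rn // (leq_trans (ltn_ord k)).
Qed.

Lemma coef_comp_scaleX p (c : R) s : (p \Po (c *: 'X))`_s = c ^+ s * p`_s.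
Proof.
rewrite coef_comp_poly.
under eq_bigr => k _ do rewrite exprZn coefZ coefXn mulrA.
have [sp|ps] := ltnP s (size p).
  rewrite (bigD1 (Ordinal sp)) //= eqxx mulr1 mulrC big1 ?addr0 // => k ks.
  by rewrite (_ : (s == k) = false) ?mulr0 // eq_sym; apply: negbTE.
rewrite nth_default // mulr0 big1 // => k _.
by rewrite gtn_eqF ?mulr0 // (leq_trans (ltn_ord k)).
Qed.

Definition shelf_eig (s : nat) : R := if odd s then 0 else 2 ^- s.

(** In [p(1 - 'X)] only the term of degree [s] reaches ['X^s], with sign [(-1)^s]; the factor is
    [(1 + (-1)^s) / 2^(s+1)]. *)
Lemma coef_shelf_op p s : (size p <= s.+1)%N ->
  (shelf_op p)`_s = shelf_eig s * p`_s.
Proof.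
move=> ps; rewrite /shelf_eig coefZ coef_comp_scaleX coefD (coef_comp_1BX _ ps).
rewrite big_ord_recr /= big1 => [|t _]; last by rewrite bin_small ?mulr0.
rewrite binn -signr_odd exprVn; case: (odd s) => /=; first by ring.
by field; rewrite expf_neq0 ?pnatr_eq0.
Qed.

Lemma size_shelf_op p : (size (shelf_op p) <= size p)%N.
Proof.
apply/leq_sizeP => s ps; rewrite coef_shelf_op ?(leqW ps) //.
by rewrite nth_default // mulr0.
Qed.

End ShelfPoly.

(** * Bernstein coefficients and the matrix [M] *)

Section Bernstein.
Variables (R : realType) (N : nat).
Implicit Types (p : {poly R}).

(* [poly_rV p *m bernstein_mx] lists the Bernstein coefficients of degree N
   of p. *)
Definition bernstein_mx : 'M[R]_N.+1 :=
  \matrix_(t, x) ((x ^_ t)%:R / (N ^_ t)%:R).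

Local Notation V := bernstein_mx.

Lemma ffactN_neq0 t : (t <= N)%N -> (N ^_ t)%:R != 0 :> R.
Proof. by move=> tN; rewrite pnatr_eq0 -lt0n ffact_gt0. Qed.

Lemma bernstein_unit : V \in unitmx.
Proof.
rewrite unitmxE -det_tr det_trig; last first.
  by apply/is_trig_mxP => x t xt; rewrite !mxE ffact_small // mul0r.
rewrite unitfE prodf_seq_neq0; apply/allP => t _ /=.
have tN : (t <= N)%N by rewrite -ltnS.
rewrite mxE mxE; apply: mulf_neq0; last by rewrite invr_eq0 ffactN_neq0.
by rewrite pnatr_eq0 -lt0n ffact_gt0.
Qed.

(** The [(-1)^s 'C(t, s)] are the coefficients of [(1 - 'X)^t], so reversing positions is the
    substitution [1 - 'X]. *)
Lemma bernstein_rev t x : V t (rev_ord x)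
  = \sum_(s < N.+1) ((-1) ^+ s * 'C(t, s)%:R) * V s x.
Proof.
have tN : (t <= N)%N by rewrite -ltnS.
have xN : (x <= N)%N by rewrite -ltnS.
rewrite mxE /= subSS -bin_ffact natrM (bin_sub_altsum R t xN).
rewrite (big_ord_widen N.+1 (fun s =>
  (-1) ^+ s * ('C(x, s) * 'C(N - s, t - s))%:R)) //.
rewrite big_mkcond !mulr_suml; apply: eq_bigr => s _.
case: ltnP => [|ts]; last by rewrite bin_small // mulr0 !mul0r.
rewrite ltnS => st; rewrite mxE.
(* This splitting cancels ['C(N - s, t - s)] and leaves the denominator [N ^_ s] of [V s x]. *)
have eN : (N ^_ t = N ^_ s * ('C(N - s, t - s) * (t - s)`!))%N.
  by rewrite bin_ffact -ffactD subnKC.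
have := ffactN_neq0 tN; rewrite eN -(bin_ffact x s) -(bin_fact st) !natrM.
by rewrite !mulf_eq0 !negb_or => /and3P[*]; field; apply/and3P.
Qed.

(** Row [t] of [V] is an eigenvector of [A] for [2^-t]: [A] acts as ['X / 2]. *)
Lemma sum_bin_bernstein t (x : 'I_N.+1) :
  \sum_(j < N.+1) 'C(x, j)%:R * V t j = 2 ^+ x / 2 ^+ t * V t x.
Proof.
rewrite mxE; under eq_bigr => j _ do rewrite mxE mulrA -natrM.
rewrite -mulr_suml mulrA; congr (_ * _).
have := congr1 (fun k => k%:R : R) (sum_bin_ffact x t).
rewrite !natrM !natrX natr_sum.
rewrite (big_ord_widen N.+1 (fun j => ('C(x, j) * j ^_ t)%:R)) //.
rewrite big_mkcond mulrC => E; rewrite mulrAC -E mulfK ?expf_neq0 ?pnatr_eq0 //.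
apply: eq_bigr => j _; case: ltnP => // xj.
by rewrite bin_small.
Qed.

Lemma bernsteinE p x : (poly_rV p *m V) 0 x = \sum_(t < N.+1) p`_t * V t x.
Proof. by rewrite mxE; apply: eq_bigr => t _; rewrite mxE. Qed.

Lemma bernstein_comp_1BX p x : (size p <= N.+1)%N ->
  (poly_rV (p \Po (1 - 'X)) *m V) 0 x = (poly_rV p *m V) 0 (rev_ord x).
Proof.
move=> pN; rewrite !bernsteinE.
under eq_bigr => s _ do rewrite (coef_comp_1BX _ pN) mulr_suml.
rewrite exchange_big; apply: eq_bigr => t _.
by rewrite bernstein_rev mulr_sumr; apply: eq_bigr => s _; rewrite -mulrA.
Qed.

(** The factorisation [M = A S]: reindexing moves the reversal from the second binomial onto [f]. *)
Lemma shelf_mulE (f : 'cV_N.+1) x : (shelf_mx R N.+1 *m f) x 0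
  = (2 ^+ x.+1)^-1 * \sum_(j < N.+1) 'C(x, j)%:R * (f j 0 + f (rev_ord j) 0).
Proof.
rewrite mxE; under eq_bigr => j _ do rewrite mxE -mulrA mulrDl.
rewrite -mulr_sumr big_split /= [X in _ + X](reindex_inj rev_ord_inj).
rewrite -big_split; congr (_ * _); apply: eq_bigr => j _.
by rewrite /= mulrDr !subSS subKn // -ltnS.
Qed.

Lemma shelf_bernstein p : (size p <= N.+1)%N ->
  poly_rV p *m V *m (shelf_mx R N.+1)^T = poly_rV (shelf_op p) *m V.
Proof.
move=> pN; rewrite -[LHS]trmxK trmx_mul trmxK; apply/rowP => x.
rewrite mxE shelf_mulE bernsteinE.
have Eq j : (poly_rV p *m V)^T j 0 + (poly_rV p *m V)^T (rev_ord j) 0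
    = \sum_(t < N.+1) (p + (p \Po (1 - 'X)))`_t * V t j.
  rewrite ![_^T _ _]mxE -(bernstein_comp_1BX _ pN) !bernsteinE -big_split.
  by apply: eq_bigr => t _; rewrite coefD mulrDl.
under eq_bigr => j _ do rewrite Eq mulr_sumr.
rewrite exchange_big mulr_sumr; apply: eq_bigr => t _.
under eq_bigr => j _ do rewrite mulrCA.
rewrite -mulr_sumr sum_bin_bernstein coefZ coef_comp_scaleX exprVn exprS.
by field; rewrite !expf_neq0 ?pnatr_eq0.
Qed.

(** * Eigenvalues, multiplicities and kernel of [M] *)

(** [V M^T = U V], where [U] is the triangular matrix of [T] on monomials, so [M] and [U] have the
    same characteristic polynomial. *)
Lemma char_poly_shelf :
  char_poly (shelf_mx R N.+1) = \prod_(t < N.+1) ('X - (shelf_eig R t)%:P).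
Proof.
pose U : 'M[R]_N.+1 := \matrix_(t < N.+1) poly_rV (shelf_op 'X^t).
have VU : V *m (shelf_mx R N.+1)^T = U *m V.
  apply/row_matrixP => t; rewrite !row_mul rowK -shelf_bernstein.
    congr (_ *m _); rewrite rowE; congr (_ *m _).
    by rewrite -rVpoly_delta rVpolyK.
  by rewrite size_polyXn.
have sU (t : 'I_N.+1) : (size (shelf_op 'X^t : {poly R}) <= t.+1)%N.
  by rewrite (leq_trans (size_shelf_op _)) // size_polyXn.
have -> : char_poly (shelf_mx R N.+1) = char_poly U.
  have VP : \det (map_mx polyC V) != 0.
    by rewrite det_map_mx polyC_eq0 -unitfE -unitmxE bernstein_unit.
  apply: (mulfI VP); rewrite [LHS]mulrC [RHS]mulrC /char_poly.
  rewrite -[X in X * _]det_tr.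
  have -> : (char_poly_mx (shelf_mx R N.+1))^T
      = 'X%:M - map_mx polyC (shelf_mx R N.+1)^T.
    by rewrite /char_poly_mx linearB /= tr_scalar_mx map_trmx.
  rewrite [LHS]mulrC -!det_mulmx mulmxBr mulmxBl -!map_mxM VU.
  by rewrite scalar_mxC.
rewrite char_poly_trig; last first.
  apply/is_trig_mxP => t s ts; rewrite !mxE nth_default //.
  exact: leq_trans (sU t) ts.
apply: eq_bigr => t _; rewrite !mxE coef_shelf_op ?size_polyXn //.
by rewrite coefXn eqxx mulr1.
Qed.

Lemma shelf_eig_inj i s : ~~ odd i -> shelf_eig R s = 2 ^- i -> s = i.
Proof.
move=> ei; rewrite /shelf_eig; case: ifP => _ /eqP.
  by rewrite eq_sym invr_eq0 expf_eq0 pnatr_eq0 andbF.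
by rewrite (inj_eq invr_inj) => /eqP /(ieexprIn (ltr0n _ 2)); apply;
  rewrite pnatr_eq1.
Qed.

Lemma mup_char_poly_shelf i : ~~ odd i -> (i <= N)%N ->
  mup (2 ^- i) (char_poly (shelf_mx R N.+1)) = 1%N.
Proof.
move=> ei iN; rewrite char_poly_shelf.
rewrite -(big_mkord xpredT (fun t => 'X - (shelf_eig R t)%:P)).
rewrite -(big_map (shelf_eig R) xpredT (fun c => 'X - c%:P)) mu_prod_XsubC.
rewrite count_map (@eq_in_count _ _ (pred1 i)) => [|s _].
  by rewrite count_uniq_mem ?iota_uniq // mem_iota subn0 add0n ltnS iN.
apply/eqP/eqP => [|->]; first exact: shelf_eig_inj.
by rewrite /shelf_eig (negbTE ei).
Qed.

(** Comparing leading coefficients, a nonzero [p] would have degree exactly [i]. *)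
Lemma shelf_op_eigen_eq0 p i : ~~ odd i -> shelf_op p = 2 ^- i *: p ->
  p`_i = 0 -> p = 0.
Proof.
move=> ei Tp pi; apply/eqP; apply: contraTT isT => p0.
have sp : (size p <= (size p).-1.+1)%N by exact: leqSpred.
have := coef_shelf_op sp; rewrite Tp coefZ => /mulIf E.
have lp : p`_(size p).-1 != 0 by rewrite -lead_coefE lead_coef_eq0.
have si := shelf_eig_inj ei (esym (E lp)).
by rewrite si pi eqxx in lp.
Qed.

Lemma shelf_eigen_unique (v w : 'rV[R]_N.+1) i : ~~ odd i ->
    v *m (shelf_mx R N.+1)^T = 2 ^- i *: v ->
    w *m (shelf_mx R N.+1)^T = 2 ^- i *: w ->
  w != 0 -> exists c, v = c *: w.
Proof.
(* [P v] is the polynomial with Bernstein coefficients [v]; it carries [M] to [T]. *)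
move=> ei; pose P v := rVpoly (v *m invmx V).
have PK u : poly_rV (P u) *m V = u by rewrite rVpolyK mulmxKV ?bernstein_unit.
have PZ c u : P (c *: u) = c *: P u by rewrite /P -scalemxAl linearZ.
have PB u1 u2 : P (u1 - u2) = P u1 - P u2 by rewrite /P mulmxBl linearB.
have PM u : shelf_op (P u) = P (u *m (shelf_mx R N.+1)^T).
  rewrite -{2}(PK u) shelf_bernstein ?size_poly // /P mulmxK ?bernstein_unit //.
  by rewrite poly_rV_K // (leq_trans (size_shelf_op _)) ?size_poly.
move=> Mv Mw w0.
have Pw0 : (P w)`_i != 0.
  apply: contraNneq w0 => Pwi; rewrite -(PK w).
  by rewrite (shelf_op_eigen_eq0 ei _ Pwi) ?linear0 ?mul0mx // PM Mw PZ.
(* This ratio kills the coefficient of ['X^i] in the polynomial of [v - c *: w]. *)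
exists ((P v)`_i / (P w)`_i); apply/eqP; rewrite -subr_eq0; apply/eqP.
set c := _ / _; pose u := v - c *: w.
rewrite -[LHS](PK u) (@shelf_op_eigen_eq0 (P u) i) ?linear0 ?mul0mx //.
  rewrite PM -PZ /u mulmxBl -scalemxAl Mv Mw scalerBr !scalerA.
  by rewrite [c * _]mulrC.
by rewrite /u PB PZ coefB coefZ divfK // subrr.
Qed.

(** The binomial matrix is unitriangular, so [M f = 0] forces [S f = 0]. *)
Lemma ker_shelf (f : 'cV[R]_N.+1) :
  (shelf_mx R N.+1 *m f == 0) = [forall j, f (rev_ord j) 0 == - f j 0].
Proof.
apply/eqP/forallP => [Mf0|fN].
  pose A : 'M[R]_N.+1 := \matrix_(x, j) 'C(x, j)%:R.
  have uA : A \in unitmx.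
    rewrite unitmxE det_trig.
      by rewrite big1 ?unitr1 // => x _; rewrite mxE binn.
    by apply/is_trig_mxP => x j xj; rewrite mxE bin_small.
  pose g : 'cV[R]_N.+1 := \col_j (f j 0 + f (rev_ord j) 0).
  have Ag : A *m g = 0.
    apply/colP => x; have /eqP := congr1 (fun M : 'cV_N.+1 => M x 0) Mf0.
    rewrite shelf_mulE [X in _ == X]mxE mulf_eq0 invr_eq0 expf_eq0.
    rewrite pnatr_eq0 /= !mxE => /eqP E.
    by rewrite -[RHS]E; apply: eq_bigr => j _; rewrite !mxE.
  have g0 : g = 0 by rewrite -(mulKmx uA g) Ag mulmx0.
  move=> j; have := congr1 (fun M : 'cV_N.+1 => M j 0) g0.
  by rewrite !mxE addrC => /eqP; rewrite addr_eq0.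
apply/colP => x; rewrite shelf_mulE mxE big1 ?mulr0 // => j _.
by rewrite (eqP (fN j)) subrr mulr0.
Qed.

End Bernstein.

(** * Eigenvectors from Bernoulli polynomials *)

Definition zeta_poly (R : realType) (B : nat -> R) (i : nat) : {poly R} :=
  2 ^+ i *: (bernoulli_poly B i \Po (2^-1 *: 'X)).

Lemma shelf_op_zeta_poly (R : realType) (B : nat -> R) (i : nat) :
  bernoulli_numbers B -> ~~ odd i ->
  shelf_op (zeta_poly B i) = 2 ^- i *: zeta_poly B i.
Proof.
move=> hB ei; rewrite /shelf_op /zeta_poly !comp_polyD !comp_polyZ -scalerDr.
rewrite !scalerA mulVf ?expf_neq0 ?pnatr_eq0 // scale1r.
rewrite -[in RHS](bernoulli_poly_dup hB) comp_polyZ mulrC; congr (_ *: _).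
rewrite comp_polyD -!comp_polyA; congr (_ + _).
(* Reflection turns [1/2 - 'X/4] into [1/2 + 'X/4], the second argument of the duplication formula
   at ['X/2]. *)
have {1}-> : bernoulli_poly B i = bernoulli_poly B i \Po (1 - 'X).
  by rewrite -{1}(bernoulli_poly_reflect hB) -signr_odd (negbTE ei) scale1r.
rewrite -comp_polyA; congr (_ \Po _).
rewrite !(comp_polyZ, comp_polyB, comp_polyD, comp_polyC, comp_polyX).
rewrite -!mul_polyC; have : (2^-1)%:P + (2^-1)%:P = 1 :> {poly R}.
  by rewrite -polyCD; congr (_%:P); lra.
move=> E; rewrite -[X in X - _]E; ring.
Qed.

Lemma zeta_vecE (R : realType) (B : nat -> R) (N i : nat) : (i <= N)%N ->
  (zeta_vec N.+1 B i)^T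
    = (N ^_ i)%:R *: (poly_rV (zeta_poly B i) *m bernstein_mx R N).
Proof.
move=> iN; apply/rowP => x; rewrite !mxE mulr_sumr.
rewrite (big_ord_widen N.+1 (fun t => w_coef N.+1 B i t * (x ^_ t)%:R)) //.
rewrite big_mkcond; apply: eq_bigr => t _; rewrite !mxE coefZ coef_comp_scaleX.
rewrite coef_poly; case: ltnP => [|_]; last by rewrite !(mulr0, mul0r).
rewrite ltnS => ti; rewrite /w_coef subSn ?(leq_trans ti) // subn1 /=.
have tN := leq_trans ti iN.
have -> : (N ^_ i = N ^_ t * (N - t) ^_ (i - t))%N by rewrite -ffactD subnKC.
have -> : 2 ^+ i = 2 ^+ (i - t) * 2 ^+ t :> R by rewrite -exprD subnK.
rewrite natrM -[_ *+ 'C(_, _)]mulr_natr exprVn; have NtR := ffactN_neq0 R tN.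
by field; rewrite NtR expf_neq0 ?pnatr_eq0.
Qed.

Lemma shelf_zeta (R : realType) (B : nat -> R) (N i : nat) :
    bernoulli_numbers B -> ~~ odd i -> (i <= N)%N ->
  shelf_mx R N.+1 *m zeta_vec N.+1 B i = 2 ^- i *: zeta_vec N.+1 B i.
Proof.
move=> hB ei iN; apply: trmx_inj; rewrite trmx_mul linearZ /= zeta_vecE //.
rewrite -scalemxAl shelf_bernstein.
  by rewrite shelf_op_zeta_poly // linearZ -scalemxAl !scalerA mulrC.
apply: leq_trans (size_scale_leq _ _) _.
apply: leq_trans (size_comp_poly_leq _ _) _.
rewrite size_scale ?size_polyX ?invr_eq0 ?pnatr_eq0 // muln1 ltnS.
by apply: leq_trans iN; rewrite -subn1 leq_subLR add1n size_poly.
Qed.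

(** The coefficient of ['X^i] in [zeta_poly B i] is [B 0 = 1]. *)
Lemma zeta_neq0 (R : realType) (B : nat -> R) (N i : nat) :
    bernoulli_numbers B -> (i <= N)%N -> zeta_vec N.+1 B i != 0.
Proof.
move=> hB iN; rewrite -trmx_eq0 zeta_vecE // scaler_eq0.
rewrite (negbTE (ffactN_neq0 R iN)).
apply: contra_neq (oner_neq0 R) => /=.
move=> /(congr1 (mulmx^~ (invmx (bernstein_mx R N)))).
rewrite mulmxK ?bernstein_unit // mul0mx => /rowP.
move=> /(_ (Ordinal (iN : i < N.+1)%N)).
rewrite !mxE coefZ coef_comp_scaleX coef_poly ltnSn subnn binn mulrA -exprMn.
rewrite divff ?pnatr_eq0 // expr1n mul1r => <-.
by have := bernoulli_sum hB 1; rewrite big_ord1.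
Qed.

Lemma rank_eigenspace_shelf (R : realType) (B : nat -> R) (N i : nat) :
    bernoulli_numbers B -> ~~ odd i -> (i <= N)%N ->
  \rank (eigenspace (shelf_mx R N.+1)^T (2 ^- i)) = 1%N.
Proof.
move=> hB ei iN; set E := eigenspace _ _; pose w := (zeta_vec N.+1 B i)^T.
have w0 : w != 0 by rewrite trmx_eq0 zeta_neq0.
have Mw : w *m (shelf_mx R N.+1)^T = 2 ^- i *: w.
  by rewrite -trmx_mul shelf_zeta // linearZ.
have wE : (w <= E)%MS by apply/eigenspaceP.
apply/eqP; rewrite eqn_leq; apply/andP; split.
  suff Ew : (E <= w)%MS by rewrite (leq_trans (mxrankS Ew)) ?rank_leq_row.
  apply/rV_subP => v vE; have Mv := eigenspaceP vE.
  by have [c ->] := shelf_eigen_unique ei Mv Mw w0; exact: scalemx_sub.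
by rewrite (leq_trans _ (mxrankS wE)) // lt0n mxrank_eq0.
Qed.

(** * The spanning set of the kernel *)

Lemma ker_shelf_span (R : realType) (n : nat) :
  lker (linfun (mulmx (shelf_mx R n.+1) : 'cV[R]_n.+1 -> 'cV[R]_n.+1))
    = <<[seq eta_vec R n.+1 j | j <- index_iota 1 (n.+1 %/ 2).+1]>>%VS.
Proof.
apply/eqP; rewrite eqEsubv; apply/andP; split; last first.
  apply/span_subvP => u /mapP[j]; rewrite mem_index_iota => jn ->.
  rewrite memv_ker lfunE /= ker_shelf; apply/forallP => k; rewrite !mxE /=.
  apply/eqP; rewrite opprB; have kn := ltn_ord k.
  by congr ((nat_of_bool _)%:R - (nat_of_bool _)%:R); lia.
apply/subvP => f; rewrite memv_ker lfunE /= ker_shelf => /forallP fN.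
have -> : f = \sum_(1 <= j < (n.+1 %/ 2).+1)
    f (inord j.-1) 0 *: eta_vec R n.+1 j.
  apply/colP => k; rewrite summxE.
  (* Only [j = k.+1] and its mirror image [n.+1 - k], both counted from 1, contribute to coordinate
     [k]. *)
  have Ek j : (1 <= j < (n.+1 %/ 2).+1)%N ->
      (f (inord j.-1) 0 *: eta_vec R n.+1 j) k 0
      = (if j == k.+1 then f k 0 else 0)
        + (if j == (n.+1 - k)%N then f k 0 else 0).
    move=> jn; rewrite !mxE mulrBr; congr (_ + _).
      rewrite eq_sym; case: eqP => [->|_]; last by rewrite mulr0.
      by rewrite mulr1 /= inord_val.
    rewrite (_ : (k.+1 == _)%N = (j == n.+1 - k)%N); last by lia.
    case: eqP => [jk|_]; last by rewrite mulr0 oppr0.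
    have -> : inord j.-1 = rev_ord k.
      by apply: val_inj; rewrite /= inordK; lia.
    by rewrite mulr1 (eqP (fN k)) opprK.
  rewrite (eq_big_nat _ _ Ek) big_split /= -!big_mkcond !big_nat1_eq.
  have := fN k; have kn := ltn_ord k.
  case: ifP => h1; case: ifP => h2; rewrite /= ?addr0 ?add0r //.
    by exfalso; lia.
  (* Neither index is in range only for the middle coordinate, where [f k = - f k]. *)
  have -> : rev_ord k = k by apply: val_inj => /=; lia.
  by rewrite -addr_eq0 -mulr2n mulrn_eq0 => /eqP.
rewrite big_seq; apply: memv_suml => j jn; apply: memvZ; apply: memv_span.
exact: map_f.
Qed.

Theorem theorem1 (R : realType) (n : nat) (hn : (2 <= n)%N)
    (B : nat -> R) (hB : bernoulli_numbers B) :
  [/\ (* kernel, M acting on column vectors *)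
      lker (linfun (mulmx (shelf_mx R n) : 'cV[R]_n -> 'cV[R]_n))
        = <<[seq eta_vec R n j | j <- index_iota 1 (n %/ 2).+1]>>%VS,
      (* 2^-i is an eigenvalue of geometric and algebraic multiplicity 1;
         eigenvalue/eigenspace act on row vectors, hence the transpose *)
      (forall i : nat, ~~ odd i -> (i <= n - 1)%N ->
        [/\ eigenvalue (shelf_mx R n)^T (2 ^- i),
            \rank (eigenspace (shelf_mx R n)^T (2 ^- i)) = 1%N
          & mup (2 ^- i) (char_poly (shelf_mx R n)) = 1%N])
    & (forall i : nat, ~~ odd i -> (i <= n - 1)%N ->
        [/\ (forall t : nat, (t <= i)%N ->
               w_coef n B i t = 2 ^+ (i - t) * B (i - t)%N * 'C(i, t)%:R
                                * ((n - t - 1)`!%:R / (n - i - 1)`!%:R)),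
            zeta_vec n B i != 0
          & shelf_mx R n *m zeta_vec n B i = 2 ^- i *: zeta_vec n B i])].
Proof.
case: n hn => // N _; split; first exact: ker_shelf_span.
  move=> i ei; rewrite subn1 /= => iN; split.
  - by rewrite /eigenvalue -mxrank_eq0 (rank_eigenspace_shelf hB).
  - exact: rank_eigenspace_shelf hB ei iN.
  - exact: mup_char_poly_shelf.
move=> i ei; rewrite subn1 /= => iN; split; last exact: shelf_zeta.
  move=> t ti; have tN := leq_trans ti iN; rewrite /w_coef; congr (_ * _).
  have -> : (N.+1 - t - 1 = N - t)%N by lia.
  (* In this form [(N - t)!] splits as a falling factorial times [(N - i)!]. *)
  have -> : (N.+1 - i - 1 = N - t - (i - t))%N by lia.
  rewrite -(@ffact_fact (N - t) (i - t)); last exact: leq_sub2r.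
  by rewrite natrM mulfK // pnatr_eq0 -lt0n fact_gt0.
exact: zeta_neq0.
Qed.
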